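(* Let $a,b:[0,+\infty)\to\mathbb R$ be Lebesgue measurable and essentially bounded, and let $g,h:[0,+\infty)\to\mathbb R$ be Lebesgue measurable and locally essentially bounded, with $g(t)\le t$, $h(t)\le t$, $\lim_{t\to+\infty}g(t)=+\infty$, $\lim_{t\to+\infty}h(t)=+\infty$, and such that for every Lebesgue null set $U\subset\mathbb R$ the sets $g^{-1}(U)$ and $h^{-1}(U)$ are Lebesgue null. Let $b(t)\ge 0$. Assume that there exist $t_0\ge 0$ and constants $\delta>0$, $\tau>0$, $b_0>0$ such that for $t\ge t_0$ $$t-g(t)\le\delta,\qquad t-h(t)\le\tau,\qquad 0<b_0\le b(t),\qquad \int_{h(t)}^t b(s)\,ds\le\frac1e,$$ and $$\|a\|_{[t_0,+\infty)}<\frac12 .$$ Then the equation $$(x(t)-a(t)x(g(t)))'+b(t)x(h(t))=0$$ is exponentially stable.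
   Context: Notation: $\|u\|_{[t_0,+\infty)}=\operatorname{ess\,sup}_{t\ge t_0}|u(t)|$. Equalities and inequalities between measurable functions are understood for almost every $t$; the function $a$ is represented by an everywhere defined function with $|a(t)|\le\|a\|_{[t_0,+\infty)}$ for all $t\ge t_0$. In integrals of $b$, one puts $b(t)=0$ for $t<0$. Solution: for an initial point $\sigma\ge t_0$ and a bounded Borel measurable initial function $\varphi:(-\infty,\sigma]\to\mathbb R$, a solution of the initial value problem $$(x(t)-a(t)x(g(t)))'+b(t)x(h(t))=0,\ t\ge\sigma,\qquad x(t)=\varphi(t),\ t\le\sigma,$$ is a Lebesgue measurable function $x:\mathbb R\to\mathbb R$, locally essentially bounded on $[\sigma,+\infty)$, such that $t\mapsto x(t)-a(t)x(g(t))$ is locally absolutely continuous on $[\sigma,+\infty)$, the differential equation holds for almost all $t\ge\sigma$, and $x(t)=\varphi(t)$ for $t\le\sigma$. (Such a solution exists and is unique.) Exponential stability: the equation is (uniformly) exponentially stable if there are $M>0$, $\gamma>0$, independent of $\sigma\ge t_0$ and $\varphi$, such that every such solution satisfies $|x(t)|\le Me^{-\gamma(t-\sigma)}\sup_{r\in(-\infty,\sigma]}|\varphi(r)|$ for (almost all) $t\ge\sigma$.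
   Formalization: The inequality g(t) ≤ t is required for every t ≥ 0, not just almost every t; otherwise g(n)=n+1 at integers, g(t)=t−1 elsewhere, a=1/4, b=1, h(t)=t gives a nonzero solution with φ=0. *)

(* Defs.v *)
From HB Require Import structures.
From mathcomp Require Import all_boot all_order all_algebra.
From mathcomp Require Import all_classical all_reals all_analysis.
From mathcomp Require Import ess_sup_inf.

Set Implicit Arguments.
Unset Strict Implicit.
Unset Printing Implicit Defensive.
Import Order.TTheory GRing.Theory Num.Theory.
Import numFieldNormedType.Exports.
Local Open Scope classical_set_scope.
Local Open Scope ring_scope.

(* The library equips [R] with its Borel sigma-algebra; [lebesgueTypeR R] is [R]
   with the sigma-algebra of Lebesgue measurable sets (Caratheodory sets of the
   outer length), i.e. the domain of [completed_lebesgue_measure]. *)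
Definition lebesgueTypeR (R : realType) :=
  caratheodory_type (wlength (idfun : R -> R))^*%mu.

Notation leb R := (@completed_lebesgue_measure R).

Definition lebesgue_measurable_fun (R : realType) (D : set R) (f : R -> R) :=
  measurable_fun (D : set (lebesgueTypeR R))
    (f : lebesgueTypeR R -> measurableTypeR R).

Definition zero_ext (R : realType) (D : set R) (u : R -> R) : R -> R :=
  fun t => if t \in D then u t else 0.

Definition ess_norm (R : realType) (D : set R) (u : R -> R) : \bar R :=
  ess_sup (leb R) (fun t => (`|zero_ext D u t|)%:E).

Definition ess_bounded (R : realType) (D : set R) (u : R -> R) :=
  (ess_norm D u < +oo)%E.

Definition loc_ess_bounded (R : realType) (s : R) (u : R -> R) :=
  forall T : R, ess_bounded `[s, T] u.

Definition absolutely_continuous (R : realType) (c d : R) (f : R -> R) :=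
  forall e : R, 0 < e -> exists2 r : R, 0 < r &
    forall (n : nat) (u v : 'I_n -> R),
      (forall i, c <= u i /\ u i <= v i /\ v i <= d) ->
      trivIset setT (fun i => `]u i, v i[%classic) ->
      \sum_(i < n) (v i - u i) < r ->
      \sum_(i < n) `|f (v i) - f (u i)| < e.

Definition loc_absolutely_continuous (R : realType) (s : R) (f : R -> R) :=
  forall T : R, absolutely_continuous s T f.

(* Only the values of [phi] on ]-oo, sigma] are relevant; here measurability is
   for the Borel sigma-algebra. *)
Definition initial_function (R : realType) (sigma : R) (phi : R -> R) :=
  measurable_fun (`]-oo, sigma] : set (measurableTypeR R))
    (phi : measurableTypeR R -> measurableTypeR R) /\
  has_ubound [set `|phi r| | r in `]-oo, sigma]].

Definition neutral_part (R : realType) (a g x : R -> R) : R -> R :=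
  fun t => x t - a t * x (g t).

Record solution (R : realType) (a b g h : R -> R) (sigma : R)
    (phi x : R -> R) : Prop := Solution {
  sol_measurable : lebesgue_measurable_fun setT x ;
  sol_bounded : loc_ess_bounded sigma x ;
  sol_ac : loc_absolutely_continuous sigma (neutral_part a g x) ;
  sol_eq : \forall t \ae (leb R), sigma <= t ->
    derivable (neutral_part a g x) t 1 /\
    derive1 (neutral_part a g x) t + b t * x (h t) = 0 ;
  sol_init : forall t, t <= sigma -> x t = phi t
}.

Definition exponentially_stable (R : realType) (t0 : R) (a b g h : R -> R) :=
  exists M gamma : R, [/\ 0 < M, 0 < gamma &
    forall (sigma : R) (phi x : R -> R), t0 <= sigma ->
      initial_function sigma phi -> solution a b g h sigma phi x ->
      \forall t \ae (leb R), sigma <= t ->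
        `|x t| <= M * expR (- gamma * (t - sigma)) *
                  sup [set `|phi r| | r in `]-oo, sigma]]].

(* Main.v *)
Require Import Defs.
From HB Require Import structures.
From mathcomp Require Import all_boot all_order all_algebra.
From mathcomp Require Import all_classical all_reals all_analysis.
From mathcomp Require Import ess_sup_inf measurable_realfun.
From mathcomp Require Import lra ring.
Set Implicit Arguments.
Unset Strict Implicit.
Unset Printing Implicit Defensive.
Import Order.TTheory GRing.Theory Num.Theory.
Import numFieldNormedType.Exports.
Local Open Scope classical_set_scope.
Local Open Scope ring_scope.

(** Write [y t = x t - a t * x (g t)], so that [y' = - b x(h)], and let
[A < 1/2] bound [|a|]. Putting [x (h t) = y (h t) + a (h t) * x (g (h t))] into
the equation turns it into the non-neutral equation
[y' + b y(h) = - b a(h) x(g(h))], whose right-hand side is [b] times a quantity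
that is at most [A] times a bound of [|x|].

The hypothesis that the integral of [b] over [[h t, t]] is at most [1/e] makes
the operator [v |-> v' + b v(h)] positive: if it maps [v] to a nonnegative
function and [v] starts nonnegative, then [v] remains nonnegative
([delay_positivity]). Hence solutions of [y' + b y(h) = b f] can be compared
with constants, and also with a slowly decaying exponential, because [b] is
bounded below: [|f| <= F w], where [w t = exp (- gamma (t - sigma))], gives
[|y| <= c w] with [c] close to [F] when [gamma] is small
([forced_delay_decay]). The equation is considered on [[sigma, +oo[] only; where
[h t < sigma], the delayed argument is replaced by [sigma], and the difference
is a forcing term controlled by the initial function, present only while
[t < sigma + tau].

So if [|x| <= K w] almost everywhere, then [|y| <= (alpha K + 6 Phi) w], where
[Phi] is the supremum of the initial function and [alpha] is slightly larger
than [A], and then [x = y + a x(g)] yields [|x| <= (2 alpha K + 6 Phi) w]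
([solution_bound_step]). Since [2 alpha < 1], iterating this improvement from
any initial bound, which local essential boundedness provides on bounded
intervals, gives [|x| <= 6 Phi / (1 - 2 alpha) w] ([ae_bound_iterate]). The
constants do not depend on the length of the interval.

Two facts of real analysis support the argument: an absolutely continuous
function with an almost everywhere nonnegative derivative is nondecreasing
([ac_ae_derive_ge0]), and the integral of [b] is a Lipschitz function with
derivative [b] almost everywhere ([integral_coefficient]). *)

(** * Lebesgue null sets and Borel sets *)

Lemma lebesgue_measurable_decomp (R : realType) (A : set R) :
  measurable (A : set (lebesgueTypeR R)) ->
  exists X N : set (measurableTypeR R),
    [/\ measurable X, (@lebesgue_measure R).-negligible N & A = X `|` N].
Proof.
move=> mA.
have : (completed_algebra_gen (@lebesgue_measure R)).-sigma.-measurable A.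
  by rewrite completed_caratheodory_measurable.
rewrite g_sigma_completed_algebra_genE => -[X mX [N negN XN]].
by exists X, N.
Qed.

(** Passing between the two measures is needed because the theorem is about the
completed measure, whereas regularity and differentiation theorems hold for the
Borel one. *)
Lemma leb_negligibleE (R : realType) :
  (leb R).-negligible = (@lebesgue_measure R).-negligible.
Proof.
apply/funext => N; apply/propext; split.
- move=> [A [/lebesgue_measurable_decomp[X [Z [mX negZ XZ]]] A0 NA]].
  suff : (@lebesgue_measure R).-negligible (X `|` Z).
    by apply: negligibleS; rewrite -XZ.
  apply: negligibleU => //; exists X; split => //; apply/eqP.
  rewrite -measure_le0 -[leRHS]A0.
  by apply: le_outer_measure; rewrite XZ; left.
- by move=> [A [mA A0 NA]]; exists A; split => //; exact: sub_caratheodory.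
Qed.

Lemma negligible_open_cover (R : realType) (N : set R) (e : R) : 0 < e ->
  (leb R).-negligible N ->
  exists U : set R, [/\ open U, N `<=` U & (lebesgue_measure U < e%:E)%E].
Proof.
move=> e0; rewrite leb_negligibleE => -[A [mA A0 NA]].
have [|U [oO AO OA]] := lebesgue_regularity_outer mA _ e0.
  by rewrite [X in (X < _)%E]A0 ltry.
exists U; split => //; first exact: subset_trans AO.
rewrite -(setDUK AO) (le_lt_trans (measureU2 _ _ _))//.
- by apply: measurableD => //; exact: open_measurable.
- by rewrite [X in (X + _)%E]A0 add0e.
Qed.

Lemma sum_disjoint_lengths (R : realType) (U : set R) (r : R) n
    (u v : 'I_n -> R) :
  open U -> (lebesgue_measure U < r%:E)%E -> (forall i, u i <= v i) ->
  trivIset setT (fun i => `]u i, v i[%classic) ->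
  (forall i, `]u i, v i[ `<=` U) -> \sum_(i < n) (v i - u i) < r.
Proof.
move=> oO Or uv tuv uvO; rewrite -lte_fin (le_lt_trans _ Or)//.
rewrite -sumEFin.
have -> : (\sum_(i < n) (v i - u i)%:E =
    \sum_(i < n) lebesgue_measure (`]u i, v i[%classic : set R))%E.
  apply: eq_bigr => i _; rewrite lebesgue_measure_itv/= lte_fin.
  by case: ltgtP (uv i) => // ->; rewrite subrr.
rewrite -measure_bigsetU_ord//.
apply: le_outer_measure.
by elim/big_ind : _ => // [A B AO BO x [/AO|/BO]].
Qed.

(** * Monotonicity of absolutely continuous functions *)

(** Cousin's compactness argument, in the form of an induction along [[c, d]]:
near each point [t], the property has to be transported only from the left of
[t] to the right of [t]. The supremum of the points that are reached is itself
reached, and is [d]. *)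
Lemma interval_induction (R : realType) (c d : R) (P : R -> Prop) :
  c <= d -> P c ->
  (forall t, c <= t <= d -> exists2 r : R, 0 < r & forall s s',
     c <= s <= d -> c <= s' <= d -> t - r < s -> s <= t -> t <= s' ->
     s' < t + r -> P s -> P s') ->
  P d.
Proof.
move=> cd Pc step.
pose S := [set s | c <= s <= d /\ P s].
have Sc : S c by split => //; rewrite lexx.
have hS : has_sup S.
  by split; [exists c|exists d => s [/andP[]]].
set m := sup S.
have cm : c <= m by apply: sup_upper_bound.
have md : m <= d by apply: ge_sup; [exists c|move=> s [/andP[]]].
have [r r0 mr] : exists2 r : R, 0 < r & forall s s',
     c <= s <= d -> c <= s' <= d -> m - r < s -> s <= m -> m <= s' ->
     s' < m + r -> P s -> P s' by apply: step; rewrite cm.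
have [s [scd Ps] ms] := sup_adherent r0 hS.
have sm : s <= m by apply: sup_upper_bound.
pose s' := Num.min d (m + r / 2).
have ms' : m <= s' by rewrite le_min md lerDl divr_ge0// ltW.
have Ps' : P s'.
  apply: (mr s) => //; first by rewrite (le_trans cm)//= ge_min lexx.
  by rewrite gt_min; apply/orP; right; lra.
have : s' <= m.
  apply: sup_upper_bound => //; split => //.
  by rewrite (le_trans cm)//= ge_min lexx.
rewrite ge_min => /orP[dm|]; last lra.
by suff -> : d = s' by []; rewrite /s' min_l//; lra.
Qed.

(** The exceptional null set is covered by an open set [U] of small measure.
Induction along [[c, d]] builds finitely many disjoint intervals inside [U] such
that, outside these, [f] decreases at rate at most [e]. The intervals have small
total length, so absolute continuity bounds the loss of [f] on them by [e].
The pointwise condition stands for [0 <= f' t]; it compares only points on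
either side of [t], as the induction requires. *)
Lemma ac_ae_increasing (R : realType) (c d : R) (f : R -> R) : c <= d ->
  Defs.absolutely_continuous c d f ->
  (\forall t \ae (leb R), c <= t -> t <= d -> forall e : R, 0 < e ->
     exists2 r : R, 0 < r & forall s s', c <= s -> s' <= d ->
       t - r < s -> s <= t -> t <= s' -> s' < t + r ->
       - (e * (s' - s)) <= f s' - f s) ->
  f c <= f d.
Proof.
move=> cd acf aef.
suff key (e : R) : 0 < e -> - (e * (d - c)) - e <= f d - f c.
  rewrite -subr_ge0; apply/ler_addgt0Pl => e e0.
  have dc : 0 < d - c + 1 by lra.
  have := key (e / (d - c + 1)); rewrite divr_gt0// => /(_ isT).
  have : e / (d - c + 1) * (d - c) + e / (d - c + 1) = e.
    by rewrite -[X in _ + X]mulr1 -mulrDr divfK// gt_eqF.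
  lra.
move=> e0.
have [r r0 acr] := acf _ e0.
have [U [oO NO Or]] := negligible_open_cover r0 aef.
(* The indexing of the intervals by [nat] makes it easy to append one; they are
   listed from left to right. *)
pose P s := exists n (u v : nat -> R),
  [/\ forall i, (i < n)%N -> [/\ c <= u i, u i <= v i, v i <= s &
                               `]u i, v i[ `<=` U],
      forall i j, (i < j)%N -> (j < n)%N -> v i <= u j &
      - (e * (s - c)) - \sum_(i < n) `|f (v i) - f (u i)| <= f s - f c].
have [n [u [v [uv uvv fuv]]]] : P d.
  apply: (@interval_induction _ c d) => //.
    exists 0%N, (fun=> 0), (fun=> 0); split => //.
    by rewrite big_ord0 !subrr mulr0 oppr0 addr0 lexx.
  move=> t /andP[ct td]; have [Ot|nOt] := pselect (U t).
    have := open_nbhs_nbhs (conj oO Ot) => -[q /= q0 qO].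
    exists q => // s s' /andP[cs _] /andP[_ s'd] tqs st ts' s'tq.
    move=> [n [u [v [uv uvv fuv]]]].
    exists n.+1, (fun i => if i == n then s else u i),
      (fun i => if i == n then s' else v i); split.
    - move=> i; rewrite ltnS leq_eqVlt => /predU1P[->|iN].
        rewrite eqxx; split => //; first lra.
        move=> z /=; rewrite in_itv/= => /andP[sz zs']; apply: qO.
        by rewrite /= ltr_norml; apply/andP; split; lra.
      rewrite (ltn_eqF iN); have [? ? vs ?] := uv _ iN; split => //.
      by rewrite (le_trans vs)//; lra.
    - move=> i j ij; rewrite ltnS leq_eqVlt => /predU1P[jn|jn].
        rewrite jn eqxx ltn_eqF -?jn//; rewrite jn in ij.
        by have [] := uv _ ij.
      by rewrite !ltn_eqF// ?uvv// (ltn_trans ij).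
    - rewrite big_ord_recr/= eqxx.
      under eq_bigr do rewrite (ltn_eqF (ltn_ord _)).
      have := ler_norm (f s - f s'); rewrite distrC.
      have : 0 <= e * (s' - s) by rewrite mulr_ge0//; lra.
      move: fuv; rewrite !mulrBr; set X := \sum_(_ < _) _; lra.
  have [q q0 qf] : exists2 r : R, 0 < r & forall s s', c <= s -> s' <= d ->
       t - r < s -> s <= t -> t <= s' -> s' < t + r ->
       - (e * (s' - s)) <= f s' - f s.
    by apply: contrapT => H; apply: nOt; apply: NO => /= /(_ ct td _ e0).
  exists q => // s s' /andP[cs _] /andP[_ s'd] tqs st ts' s'tq.
  move=> [n [u [v [uv uvv fuv]]]].
  exists n, u, v; split => //.
    move=> i iN; have [? ? vs ?] := uv _ iN; split => //.
    by rewrite (le_trans vs)//; lra.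
  have := qf _ _ cs s'd tqs st ts' s'tq.
  move: fuv; rewrite !mulrBr; set X := \sum_(_ < _) _; lra.
suff : \sum_(i < n) `|f (v i) - f (u i)| < e by move: fuv; lra.
have tuv : trivIset setT (fun i : 'I_n => `]u i, v i[%classic).
  apply/trivIsetP => i j _ _ ij.
  wlog: i j ij / (i < j)%N.
    move=> wlg; have [|ji|/ord_inj/eqP] := ltngtP i j; first exact: wlg.
      by rewrite setIC wlg// eq_sym.
    by rewrite (negbTE ij).
  move=> {}ij; apply/seteqP; split => // z [] /=.
  rewrite !in_itv/= => /andP[_ zv] /andP[uz _].
  have := uvv _ _ ij (ltn_ord j); lra.
apply: acr => //.
- by move=> i; have [? ? ?] := uv _ (ltn_ord i).
- apply: sum_disjoint_lengths oO Or _ tuv _ => i.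
    by have [] := uv _ (ltn_ord i).
  by have [] := uv _ (ltn_ord i).
Qed.

#[local] Instance ae_leb_filter (R : realType) :
  Filter (nbhs (almost_everywhere (leb R))).
Proof. exact: ae_filter_ringOfSetsType. Qed.

Section AbsoluteContinuity.
Context {R : realType}.
Implicit Types (c d : R) (f g : R -> R).

Lemma absolutely_continuousS c d c' d' f : c <= c' -> d' <= d ->
  Defs.absolutely_continuous c d f -> Defs.absolutely_continuous c' d' f.
Proof.
move=> cc' d'd acf e /acf[r r0 fr]; exists r => // n u v uv.
by apply: fr => i; have [? [? ?]] := uv i; split; [|split]; lra.
Qed.

Lemma lipschitz_absolutely_continuous c d f (k : R) :
  (forall s t, c <= s -> s <= t -> t <= d -> `|f t - f s| <= k * (t - s)) ->
  Defs.absolutely_continuous c d f.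
Proof.
move=> fk e e0.
have k0 : 0 < `|k| + 1 by rewrite ltr_wpDl.
exists (e / (`|k| + 1)); first exact: divr_gt0.
move=> n u v uv _; rewrite ltr_pdivlMr// => uve.
apply: le_lt_trans uve; rewrite mulr_suml; apply: ler_sum => i _.
have [cu [uivi vd]] := uv i.
apply: (le_trans (fk _ _ cu uivi vd)); rewrite mulrC ler_wpM2l ?subr_ge0//.
by rewrite (le_trans (ler_norm _))// lerDl.
Qed.

Lemma absolutely_continuousD c d f g :
  Defs.absolutely_continuous c d f -> Defs.absolutely_continuous c d g ->
  Defs.absolutely_continuous c d (f \+ g).
Proof.
move=> acf acg e e0; have e20 : 0 < e / 2 by rewrite divr_gt0.
have [r r0 fr] := acf _ e20; have [q q0 gq] := acg _ e20.
exists (Num.min r q); first by rewrite lt_min r0.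
move=> n u v uv tuv; rewrite lt_min => /andP[uvr uvq].
rewrite [e]splitr.
apply: le_lt_trans (ltrD (fr _ _ _ uv tuv uvr) (gq _ _ _ uv tuv uvq)).
rewrite -big_split/=; apply: ler_sum => i _.
by rewrite opprD addrACA ler_normD.
Qed.

Lemma absolutely_continuousZ (k : R) c d f :
  Defs.absolutely_continuous c d f ->
  Defs.absolutely_continuous c d (fun t => k * f t).
Proof.
move=> acf e e0; have k0 : 0 < `|k| + 1 by rewrite ltr_wpDl.
have [r r0 fr] := acf _ (divr_gt0 e0 k0).
exists r => // n u v uv tuv uvr.
have := fr _ _ _ uv tuv uvr; rewrite ltr_pdivlMr//; apply: le_lt_trans.
rewrite mulr_suml; apply: ler_sum => i _.
by rewrite -mulrBr normrM mulrC ler_wpM2l// lerDl.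
Qed.

Lemma absolutely_continuous_within c d f :
  Defs.absolutely_continuous c d f -> {within `[c, d], continuous f}.
Proof.
move=> acf; apply/subspace_continuousP => x /=; rewrite in_itv/= => /andP[cx xd].
apply/cvgrPdist_lt => e e0; have [r r0 fr] := acf _ e0.
rewrite near_withinE; exists r => // t /= xtr; rewrite in_itv/= => /andP[ct td].
have key (p q : R) : c <= p -> p <= q -> q <= d -> q - p < r -> `|f q - f p| < e.
  move=> cp pq qd qpr.
  have := fr 1%N (fun=> p) (fun=> q); rewrite !big_ord1; apply => //.
  by apply/trivIsetP => i j _ _; rewrite !ord1 eqxx.
have [xt|/ltW tx] := leP x t.
- rewrite distrC; apply: key => //.
  by apply: le_lt_trans xtr; rewrite distrC ler_norm.
- by apply: key => //; apply: le_lt_trans xtr; rewrite ler_norm.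
Qed.

End AbsoluteContinuity.

Lemma derive_ge0_locally_increasing (R : realType) (f : R -> R) (t e : R) :
  derivable f t 1 -> 0 <= derive1 f t -> 0 < e ->
  exists2 r : R, 0 < r & forall s s',
    t - r < s -> s <= t -> t <= s' -> s' < t + r ->
    - (e * (s' - s)) <= f s' - f s.
Proof.
move=> df f'0 e0.
have /cvgrPdist_lt/(_ _ e0) := df; rewrite -/(derive _ _ _) -derive1E.
move=> [r /= r0 fr].
have quot h : h != 0 -> `|h| < r -> - e <= h^-1 * (f (h + t) - f t).
  move=> h0 hr; have := fr h; rewrite /= sub0r normrN => /(_ hr h0).
  rewrite /shift/= [h *: 1]mulr1 ltr_norml => /andP[_].
  rewrite /GRing.scale/=; lra.
have right h : 0 < h -> h < r -> - (e * h) <= f (h + t) - f t.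
  move=> h0 hr; have := quot h; rewrite gt_eqF// gtr0_norm// => /(_ isT hr).
  by rewrite mulrC ler_pdivlMr// mulNr.
have left h : 0 < h -> h < r -> - (e * h) <= f t - f (t - h).
  move=> h0 hr; have := quot (- h); rewrite oppr_eq0 gt_eqF// normrN gtr0_norm//.
  move=> /(_ isT hr).
  rewrite invrN mulNr -mulrN opprB mulrC ler_pdivlMr// mulNr.
  by rewrite (addrC (- h)).
exists r => // s s' trs st ts' s'tr.
have R0 : - (e * (s' - t)) <= f s' - f t.
  move: ts'; rewrite le_eqVlt => /predU1P[->|ts'].
    by rewrite !subrr mulr0 oppr0.
  by have := right (s' - t); rewrite subrK; apply; lra.
have L0 : - (e * (t - s)) <= f t - f s.
  move: st; rewrite le_eqVlt => /predU1P[->|st].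
    by rewrite !subrr mulr0 oppr0.
  by have := left (t - s); rewrite subKr; apply; lra.
by move: R0 L0; rewrite !mulrBr; lra.
Qed.

(** Without absolute continuity this fails, as the opposite of the Cantor
function shows. *)
Lemma ac_ae_derive_ge0 (R : realType) (c d : R) (f : R -> R) : c <= d ->
  Defs.absolutely_continuous c d f ->
  (\forall t \ae (leb R), c <= t -> t <= d ->
     derivable f t 1 /\ 0 <= derive1 f t) ->
  f c <= f d.
Proof.
move=> cd acf aef; apply: (ac_ae_increasing cd acf).
apply: filterS aef => t ft ct td e e0; have [df f'0] := ft ct td.
have [r r0 fr] := derive_ge0_locally_increasing df f'0 e0.
by exists r => // s s' _ _; exact: fr.
Qed.

(** * Positivity of the delay equation *)

Lemma expRN_lipschitz (R : realType) (p q : R) : 0 <= p -> p <= q ->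
  `|expR (- q) - expR (- p)| <= q - p.
Proof.
move=> p0 pq; rewrite distrC ger0_norm ?subr_ge0 ?ler_expR ?lerN2//.
have -> : expR (- p) - expR (- q) = expR (- p) * (1 - expR (- (q - p))).
  by rewrite mulrBr mulr1 -expRD; congr (_ - expR _); lra.
have e1 : expR (- p) <= 1 by rewrite -expR0 ler_expR; lra.
have := expR_ge1Dx (- (q - p)); have := expR_ge0 (- p).
have : expR (- (q - p)) <= 1 by rewrite -expR0 ler_expR; lra.
set x := expR (- p) in e1 *; set y := expR _; nra.
Qed.

(** Let [e^(e B) v] attain its maximum [M >= 0] over [[s, T]] at [m], and let
[z = v - M e^(- e B)]. Then [z <= 0] on [[s, T]] and [z m = 0]. At almost every
[t], as [v (H t) <= M e^(- e B (H t))] and [e (B t - B (H t)) <= 1],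
[[z' t >= - b t * v (H t) + e b t M e^(- e B t)
        >= b t M e^(- e B t) (e - e^(e (B t - B (H t)))) >= 0.]]
So [z] is nondecreasing on [[m, T]], and [v T >= M e^(- e B T) >= 0]. The
exponent [e] is the rate for which a delay of [1/e], measured by [B], is exactly
compensated. *)
Lemma delay_positivity (R : realType) (s T k : R) (v B b H : R -> R) :
  s <= T -> Defs.absolutely_continuous s T v ->
  (forall t, s <= t -> 0 <= B t) ->
  (forall p q, s <= p -> p <= q -> q <= T -> 0 <= B q - B p <= k * (q - p)) ->
  (\forall t \ae (leb R), s <= t -> t <= T ->
     [/\ is_derive t 1 B (b t), 0 <= b t, s <= H t <= t,
         B t - B (H t) <= (expR 1)^-1 &
         derivable v t 1 /\ 0 <= derive1 v t + b t * v (H t)]) ->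
  0 <= v s -> 0 <= v T.
Proof.
move=> sT acv B0 Bk aev vs.
pose e : R := expR 1.
have e0 : 0 < e by exact: expR_gt0.
pose E t := expR (- (e * B t)).
have acE : Defs.absolutely_continuous s T E.
  apply: (@lipschitz_absolutely_continuous _ _ _ _ (e * k)) => p q sp pq qT.
  have /andP[Bpq Bqp] := Bk _ _ sp pq qT.
  apply: (le_trans (expRN_lipschitz _ _)).
  - by apply: mulr_ge0; [exact: ltW|exact: B0].
  - by rewrite ler_pM2l//; lra.
  - by rewrite -mulrBr -mulrA ler_pM2l.
have acB : Defs.absolutely_continuous s T B.
  apply: (@lipschitz_absolutely_continuous _ _ _ _ k) => p q sp pq qT.
  by have /andP[Bpq Bqp] := Bk _ _ sp pq qT; rewrite ger0_norm.
have [m] : exists2 m, m \in `[s, T] & forall t, t \in `[s, T] ->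
    expR (e * B t) * v t <= expR (e * B m) * v m.
  apply: EVT_max => //.
  have cB := absolutely_continuous_within acB.
  have cv := absolutely_continuous_within acv.
  move=> x; apply: cvgM; last exact: cv.
  apply: (@continuous_comp _ _ _ (fun t : subspace `[s, T] => e * B t) expR x).
    by apply: cvgMr; exact: cB.
  exact: continuous_expR.
rewrite in_itv/= => /andP[sm mT]; set M := _ * v m => maxM.
have M0 : 0 <= M.
  apply: le_trans (maxM s _); last by rewrite in_itv/= lexx.
  by rewrite mulr_ge0// expR_ge0.
pose z t := v t - M * E t.
have vE t : s <= t -> t <= T -> v t <= M * E t.
  move=> st tT; have := maxM t; rewrite in_itv/= st tT => /(_ isT).
  by rewrite /E expRN ler_pdivlMr ?expR_gt0// mulrC.
have zm : z m = 0.
  by rewrite /z /M mulrAC /E -expRD subrr expR0 mul1r subrr.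
suff : z m <= z T.
  rewrite zm subr_ge0; apply: le_trans.
  by rewrite mulr_ge0// expR_ge0.
apply: ac_ae_derive_ge0 => //.
  apply: (@absolutely_continuousS _ s T) => //.
  have := absolutely_continuousD acv (absolutely_continuousZ (- M) acE).
  by rewrite (_ : _ \+ _ = z)//; apply/funext => t; rewrite /z/= mulNr.
apply: filterS aev => t aet mt tT.
have [dB b0 /andP[sH Ht] BH [dv v'ge]] := aet (le_trans sm mt) tT.
have dz : is_derive t 1 z (derive1 v t + M * (E t * (e * b t))).
  have dv' : is_derive t 1 v (derive1 v t).
    by rewrite derive1E; exact: derivableP.
  rewrite /z /E; apply: is_derive_eq.
  by rewrite /GRing.scale/=; ring.
rewrite derive1E; split; first exact: ex_derive.
rewrite derive_val.
(* This is the only place where the bound [1/e] on the delay is used. *)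
have vH : v (H t) <= M * (e * E t).
  apply: (le_trans (vE _ sH (le_trans Ht tT))); rewrite ler_wpM2l//.
  rewrite /E -expRD ler_expR.
  have : e * (B t - B (H t)) <= 1 by rewrite mulrC -ler_pdivlMr// div1r.
  rewrite mulrBr; lra.
have : b t * v (H t) <= b t * (M * (e * E t)) by rewrite ler_wpM2l.
have -> : M * (E t * (e * b t)) = b t * (M * (e * E t)) by ring.
by lra.
Qed.

(** * The integral of the coefficient *)

(** The function [u] is the supremum of the step functions [q 1_(u > q)], where
[q] runs over the rational numbers of [[0, k]]. Replacing each set [u > q] by
a Borel set that differs from it by a null set gives [v]. *)
Lemma lebesgue_Borel_version (R : realType) (u : R -> R) (k : R) : 0 <= k ->
  (forall c, measurable ([set t | c < u t] : set (lebesgueTypeR R))) ->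
  (\forall t \ae (leb R), 0 <= u t <= k) ->
  exists v : R -> R,
    [/\ measurable_fun (setT : set (measurableTypeR R))
          (v : measurableTypeR R -> measurableTypeR R),
        forall t, 0 <= v t <= k &
        \forall t \ae (leb R), v t = u t].
Proof.
move=> k0 mu aeu.
pose q n : R := if unpickle n is Some r then
  if 0 <= (ratr r : R) <= k then ratr r else 0 else 0.
have q0k n : 0 <= q n <= k.
  by rewrite /q; case: unpickle => [r|]; [case: ifPn|]; rewrite ?lexx ?k0.
have /choice[X /all_and2[mX XN]] n : exists X : set (measurableTypeR R),
    measurable X /\ \forall t \ae (leb R), X t <-> q n < u t.
  have [X [N [mX negN XN]]] := lebesgue_measurable_decomp (mu (q n)).
  exists X; split => //; rewrite /almost_everywhere leb_negligibleE.
  apply: negligibleS negN => t /=.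
  have -> : (q n < u t) = ([set t | q n < u t] t) :> Prop by [].
  rewrite XN => XNt; apply: contrapT => nN; apply: XNt; split; first by left.
  by case.
pose f n t : R := q n * \1_(X n) t.
have f0k n t : 0 <= f n t <= k.
  have /andP[q0 qk] := q0k n.
  by rewrite /f indicE; case: (t \in X n); rewrite ?mulr1 ?mulr0 ?lexx ?k0 ?q0.
have ubf t n : ubound (sdrop (f^~ t) n) k.
  by move=> _ [m _ <-]; have /andP[] := f0k m t.
have hsf t : has_sup (sdrop (f^~ t) 0).
  by split; [exists (f 0%N t), 0%N|exists k].
have lef t n : f n t <= sups (f^~ t) 0.
  by apply: sup_upper_bound => //; exists n.
have v0k t : 0 <= sups (f^~ t) 0 <= k.
  have /andP[f0 _] := f0k 0%N t.
  rewrite (le_trans f0 (lef _ _))/=; apply: ge_sup; last exact: ubf.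
  by exists (f 0%N t), 0%N.
exists (fun t => sups (f^~ t) 0); split => //.
- apply: measurable_fun_sups.
    by move=> t _; exists k => _ [m _ <-]; have /andP[] := f0k m t.
  by move=> n; exact: measurable_funM.
- have := ae_foralln XN; apply: filterS2 aeu => t /andP[u0 uk] XNt.
  apply/eqP; rewrite eq_le; apply/andP; split.
    apply: ge_sup; first by exists (f 0%N t), 0%N.
    move=> _ [m _ <-]; rewrite /f indicE.
    have [/set_mem/XNt|] := boolP (t \in X m); last by rewrite mulr0.
    by rewrite mulr1 => /ltW.
  rewrite leNgt; apply/negP => /rat_in_itvoo[r].
  rewrite in_itv/= => /andP[vr ru].
  have /andP[v0 _] := v0k t.
  have qr : q (pickle r) = ratr r.
    by rewrite /q pickleK (le_trans v0 (ltW vr)) (le_trans (ltW ru) uk).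
  have : f (pickle r) t = ratr r.
    rewrite /f qr indicE mem_set ?mulr1//; apply/XNt.
    by rewrite qr.
  by have := lef t (pickle r) => /[swap] ->; rewrite leNgt vr.
Qed.

(** The Borel measure is the image of the completed one under the identity. *)
Lemma leb_integral_Borel (R : realType) (D : set R) (v : R -> R) :
  measurable (D : set (measurableTypeR R)) ->
  measurable_fun (setT : set (measurableTypeR R))
    (v : measurableTypeR R -> measurableTypeR R) ->
  (forall t, 0 <= v t) ->
  (\int[leb R]_(t in D) (v t)%:E = \int[lebesgue_measure]_(t in D) (v t)%:E)%E.
Proof.
move=> mD mv v0.
have mid : measurable_fun setT (idfun : lebesgueTypeR R -> measurableTypeR R).
  by move=> _ Y mY; rewrite setTI; exact: sub_caratheodory.
have := @ge0_integral_pushforward _ _ _ _ _ _ mid (leb R) D (EFin \o v) mD.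
move=> -> //.
  apply/measurable_EFinP; exact: measurable_funS mv.
by move=> t _; rewrite lee_fin.
Qed.

Lemma ess_bounded_ae (R : realType) (D : set R) (f : R -> R) :
  ess_bounded D f ->
  exists2 k : R, 0 <= k & \forall t \ae (leb R), D t -> `|f t| <= k.
Proof.
rewrite /ess_bounded => fD.
exists (Num.max 0 (fine (ess_norm D f))); first by rewrite le_max lexx.
apply: filterS (ess_sup_ge (leb R) (fun t => (`|zero_ext D f t|)%:E)) => t.
rewrite -/(ess_norm D f) => + Dt; rewrite {1}/zero_ext mem_set//.
move: fD; case: (ess_norm D f) => [r| |]//= _.
by rewrite lee_fin le_max => ->; rewrite orbT.
Qed.

(** [B] is an antiderivative of a Borel version of [b], to which Lebesgue's
differentiation theorem applies. The last clause bounds its increments by the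
integral of [b] with respect to the completed measure; the interval of
integration may extend to the left of [p], even to negative points, since
the integrand is nonnegative. *)
Lemma integral_coefficient (R : realType) (b : R -> R) :
  lebesgue_measurable_fun `[0, +oo[ b -> ess_bounded `[0, +oo[ b ->
  (\forall t \ae (leb R), 0 <= t -> 0 <= b t) ->
  exists (B : R -> R) (k : R),
    [/\ forall p q, 0 <= p -> p <= q -> 0 <= B q - B p <= k * (q - p),
        forall t, 0 <= t -> 0 <= B t,
        \forall t \ae (leb R), (0 : R) <= t -> is_derive t 1 B (b t) &
        forall p h t, 0 <= p -> p <= t -> h <= p ->
          ((B t - B p)%:E <=
           \int[leb R]_(s in `[h, t]) (zero_ext `[0%R, +oo[ b s)%:E)%E].
Proof.
move=> mb bb b0.
pose u := zero_ext `[0%R, +oo[ b.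
have uE t : u t = if 0 <= t then b t else 0.
  by rewrite /u /zero_ext mem_setE in_itv/= andbT.
have mu : measurable_fun setT (u : lebesgueTypeR R -> measurableTypeR R).
  have -> : u = b \_ `[0%R, +oo[.
    by apply/funext => t; rewrite patchE.
  apply/(measurable_restrictT _ _).1 => //.
  by apply: sub_caratheodory; exact: measurable_itv.
have mug c : measurable ([set t | c < u t] : set (lebesgueTypeR R)).
  have -> : [set t | c < u t] = setT `&` u @^-1` `]c, +oo[.
    by rewrite setTI; apply/funext => t; rewrite /= in_itv/= andbT.
  by apply: mu => //; exact: (measurable_itv `]c, +oo[).
have [k k0 bk] := ess_bounded_ae bb.
have uk : \forall t \ae (leb R), 0 <= u t <= k.
  apply: filterS2 b0 bk => t b0 bk; rewrite uE; case: ifPn => t0.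
    rewrite b0//=; apply: (le_trans (ler_norm _)); apply: bk.
    by rewrite /= in_itv/= t0.
  by rewrite lexx k0.
have [v [mv v0k vu]] := lebesgue_Borel_version k0 mug uk.
have v0 t : 0 <= v t by have /andP[] := v0k t.
have vk t : v t <= k by have /andP[] := v0k t.
have itvoo p q : (lebesgue_measure (`]p, q]%classic : set R) < +oo)%E.
  by rewrite lebesgue_measure_itv; case: ifP => _; rewrite ltry.
have iv (i : interval R) : (lebesgue_measure ([set` i] : set R) < +oo)%E ->
    lebesgue_measure.-integrable [set` i] (EFin \o v).
  move=> ioo; apply: measurable_bounded_integrable => //.
    exact: measurable_funS mv.
  exists k; split; first exact: num_real.
  by move=> x kx t _ /=; rewrite ger0_norm// (le_trans (vk t))// ltW.
have ivc p q : lebesgue_measure.-integrable `[p, q] (EFin \o v).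
  by apply: iv; rewrite lebesgue_measure_itv; case: ifP => _; rewrite ltry.
(* Starting from [-1] makes [0] an interior point, so that differentiation at
   [t = 0] is not exceptional. *)
pose B t : R := \int[lebesgue_measure]_(s in `[- 1, t]) v s.
have BE p q : 0 <= p -> p <= q ->
    B q - B p = \int[lebesgue_measure]_(s in `]p, q]) v s.
  by move=> p0 pq; rewrite /B Rintegral_itvB ?bnd_simp//; lra.
have ivo p q : lebesgue_measure.-integrable `]p, q] (EFin \o v).
  by apply: iv; exact: itvoo.
exists B, k; split.
- move=> p q p0 pq; rewrite BE//; apply/andP; split.
    exact: Rintegral_ge0.
  apply: (@le_trans _ _ (\int[lebesgue_measure]_(s in `]p, q]) (cst k s))).
    apply: le_Rintegral => //.
    apply: (measurable_bounded_integrable _ (itvoo p q)) => //.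
    exists k; split; first exact: num_real.
    by move=> x kx t _ /=; rewrite ger0_norm// ltW.
  have mpq : lebesgue_measure (`]p, q]%classic : set R) = (q - p)%:E.
    rewrite lebesgue_measure_itv/= lte_fin.
    by case: ltgtP pq => // -> _; rewrite subrr.
  by rewrite Rintegral_cst// [X in fine X]mpq.
- by move=> t t0; apply: Rintegral_ge0.
- have lv : locally_integrable setT v.
    split => //; first exact: openT.
    move=> K _ cK.
    apply: (@le_lt_trans _ _ (\int[lebesgue_measure]_(x in K) cst k%:E x)%E).
      apply: ge0_le_integral => //=; first exact: compact_measurable.
      - by apply/measurable_EFinP; apply: measurableT_comp => //; exact: measurable_funS mv.
      - by move=> t _; rewrite lee_fin ger0_norm.
    rewrite integral_cst//=; last exact: compact_measurable.
    rewrite lte_mul_pinfty ?lee_fin//; exact: compact_finite_measure.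
  have := FTC1 (a := BLeft (- 1)) _ lv => /(_ (fun y => ivc _ y)).
  rewrite /almost_everywhere -leb_negligibleE => Bv.
  apply: filterS2 Bv vu => t Bv vu t0.
  have [|dB B'] := Bv.
    by rewrite lte_fin (lt_le_trans _ t0)// ltrN10.
  apply: DeriveDef => //.
  by rewrite -derive1E B' vu uE t0.
- move=> p h t p0 pt hp; rewrite BE//.
  rewrite /Rintegral fineK; last exact: integrable_fin_num.
  have -> : (\int[leb R]_(s in `[h, t]) (u s)%:E =
             \int[leb R]_(s in `[h, t]) (v s)%:E)%E.
    apply: ae_eq_integral.
    - by apply: sub_caratheodory; exact: measurable_itv.
    - by apply/measurable_EFinP; exact: measurable_funS mu.
    - apply/measurable_EFinP; apply: (@measurable_funS _ _ _ _ setT) => //.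
      move=> _ Y mY; rewrite setTI; apply: sub_caratheodory.
      by rewrite -[X in _ X]setTI; exact: mv.
    - by apply: filterS vu => s -> _.
  rewrite leb_integral_Borel//.
  apply: ge0_subset_integral => //.
    by apply/measurable_EFinP; exact: measurable_funS mv.
    by move=> s _; rewrite lee_fin.
  move=> s /=; rewrite !in_itv/= => /andP[ps st].
  by apply/andP; split => //; exact: le_trans (ltW ps).
Qed.

(** * Decay of the forced delay equation *)

(** The function [v = c w + y], with [w t = exp (- gamma (t - s))], satisfies
[v' + b v(H) >= b w (c (1 - gamma / b0) - F) >= 0], because [w] is decreasing and
[gamma <= gamma b / b0]. *)
Lemma forced_delay_lower (R : realType) (s T k b0 gamma c F : R)
    (y B b H : R -> R) :
  s <= T -> Defs.absolutely_continuous s T y ->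
  (forall t, s <= t -> 0 <= B t) ->
  (forall p q, s <= p -> p <= q -> q <= T -> 0 <= B q - B p <= k * (q - p)) ->
  0 <= gamma -> 0 < b0 -> 0 <= c -> F <= c * (1 - gamma / b0) ->
  (\forall t \ae (leb R), s <= t -> t <= T ->
     [/\ is_derive t 1 B (b t), b0 <= b t, s <= H t <= t,
         B t - B (H t) <= (expR 1)^-1 &
         derivable y t 1 /\
         - (b t * (F * expR (- gamma * (t - s)))) <=
           derive1 y t + b t * y (H t)]) ->
  - c <= y s -> - (c * expR (- gamma * (T - s))) <= y T.
Proof.
move=> sT acy B0 Bk g0 b00 c0 Fc aey ys.
pose w t := expR (- gamma * (t - s)).
rewrite -subr_ge0 opprK addrC.
apply: (delay_positivity (v := fun t => c * w t + y t) sT _ B0 Bk).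
- apply: absolutely_continuousD acy; apply: absolutely_continuousZ.
  apply: (@lipschitz_absolutely_continuous _ _ _ _ gamma) => p q sp pq qT.
  rewrite /w !mulNr; apply: (le_trans (expRN_lipschitz _ _)).
  + by rewrite mulr_ge0// subr_ge0.
  + by rewrite ler_wpM2l//; lra.
  + by rewrite -mulrBr ler_wpM2l//; lra.
- apply: filterS aey => t aet st tT.
  have [dB bb0 sHt BH [dy y'ge]] := aet st tT.
  have /andP[sH Ht] := sHt.
  have b0t : 0 <= b t by exact: le_trans (ltW b00) bb0.
  split; [exact: dB|exact: b0t|exact: sHt|exact: BH|].
  have dy' : is_derive t 1 y (derive1 y t).
    by rewrite derive1E; exact: derivableP.
  have dv : is_derive t 1 (fun t => c * w t + y t)
      (- (gamma * (c * w t)) + derive1 y t).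
    by apply: is_derive_eq; rewrite /GRing.scale/= /w; ring.
  rewrite derive1E; split; first exact: ex_derive.
  rewrite derive_val.
  have w0 : 0 <= w t by exact: expR_ge0.
  have wH : w t <= w (H t).
    by rewrite ler_expR !mulNr lerN2 ler_wpM2l//; lra.
  have : b t * (c * w t) <= b t * (c * w (H t)) by rewrite !ler_wpM2l.
  have : gamma * (c * w t) <= gamma / b0 * b t * (c * w t).
    apply: ler_wpM2r; first exact: mulr_ge0.
    by rewrite -mulrA ler_peMr// ler_pdivlMl// mulr1.
  have : b t * (F * w t) <= b t * (c * (1 - gamma / b0) * w t).
    by rewrite ler_wpM2l// ler_wpM2r.
  move: y'ge; rewrite -/(w t).
  have -> : b t * (c * (1 - gamma / b0) * w t) =
    b t * (c * w t) - gamma / b0 * b t * (c * w t) by ring.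
  rewrite mulrDr; lra.
- by rewrite /w subrr mulr0 expR0 mulr1; lra.
Qed.

Lemma forced_delay_decay (R : realType) (s T k b0 gamma c F : R)
    (y B b H : R -> R) :
  s <= T -> Defs.absolutely_continuous s T y ->
  (forall t, s <= t -> 0 <= B t) ->
  (forall p q, s <= p -> p <= q -> q <= T -> 0 <= B q - B p <= k * (q - p)) ->
  0 <= gamma -> 0 < b0 -> 0 <= c -> F <= c * (1 - gamma / b0) ->
  (\forall t \ae (leb R), s <= t -> t <= T ->
     [/\ is_derive t 1 B (b t), b0 <= b t, s <= H t <= t,
         B t - B (H t) <= (expR 1)^-1 &
         derivable y t 1 /\
         `|derive1 y t + b t * y (H t)| <=
           b t * (F * expR (- gamma * (t - s)))]) ->
  `|y s| <= c -> `|y T| <= c * expR (- gamma * (T - s)).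
Proof.
move=> sT acy B0 Bk g0 b00 c0 Fc aey; rewrite !ler_norml => /andP[ys1 ys2].
apply/andP; split.
  apply: (forced_delay_lower sT acy B0 Bk g0 b00 c0 Fc _ ys1).
  apply: filterS aey => t aet st tT; have [dB bb0 sHt BH [dy]] := aet st tT.
  rewrite ler_norml => /andP[yge _].
  by split; [exact: dB|exact: bb0|exact: sHt|exact: BH|split].
rewrite -lerN2.
apply: (forced_delay_lower (y := fun t => - y t) sT _ B0 Bk g0 b00 c0 Fc).
- have := absolutely_continuousZ (- 1) acy.
  by rewrite (_ : (fun t => -1 * y t) = (fun t => - y t))//;
    apply/funext => t; rewrite mulN1r.
- apply: filterS aey => t aet st tT; have [dB bb0 sHt BH [dy]] := aet st tT.
  rewrite ler_norml => /andP[_ yle].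
  split; [exact: dB|exact: bb0|exact: sHt|exact: BH|].
  have dy' : is_derive t 1 y (derive1 y t).
    by rewrite derive1E; exact: derivableP.
  have dv : is_derive t 1 (fun t => - y t) (- derive1 y t).
    by apply: is_derive_eq.
  rewrite derive1E; split; first exact: ex_derive.
  by rewrite derive_val mulrN -opprD lerN2.
- by rewrite lerN2.
Qed.

(** * Bounds for the solutions of the neutral equation *)

(** Almost everywhere bounds on [x] pass to [x \o g] and [x \o h] because the
preimages of null sets are null. *)
Lemma ae_comp_nonsingular (R : realType) (g : R -> R) (P : R -> Prop) :
  (forall U : set R, (leb R).-negligible U ->
     (leb R).-negligible (`[0, +oo[ `&` g @^-1` U)) ->
  (\forall t \ae (leb R), P t) ->
  \forall t \ae (leb R), (0 : R) <= t -> P (g t).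
Proof.
move=> gN /gN; apply: negligibleS => t /= Pt; split.
  by rewrite in_itv/= andbT leNgt; apply/negP => t0; apply: Pt; rewrite leNgt t0.
by move=> Pgt; apply: Pt.
Qed.

(** One improvement of an exponential bound: [K] is replaced by
[c + A K e^(gamma delta)], where [c] is the bound that [forced_delay_decay]
gives for the neutral part. The factors [e^(gamma delta)] and
[e^(gamma (delta + tau))] are what the weight loses under the delays. The two
terms of the forcing bound correspond to [h t >= s], where the forcing is
[- a (h t) * x (g (h t))], and to [h t < s], where it is [y s - phi (h t)] with
[|y s| <= 2 Phi]; in the latter case [t < s + tau]. *)
Lemma solution_bound_step (R : realType) (a b g h phi x B : R -> R)
    (s T A Phi K delta tau b0 gamma k c : R) :
  0 <= s -> s <= T -> solution a b g h s phi x ->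
  (forall r, r <= s -> `|phi r| <= Phi) -> Phi <= K ->
  (forall t, s <= t -> `|a t| <= A) -> A <= 1 ->
  (forall t, 0 <= t -> g t <= t) ->
  (forall U : set R, (leb R).-negligible U ->
     (leb R).-negligible (`[0, +oo[ `&` g @^-1` U)) ->
  (forall U : set R, (leb R).-negligible U ->
     (leb R).-negligible (`[0, +oo[ `&` h @^-1` U)) ->
  (\forall t \ae (leb R), s <= t -> t - g t <= delta) ->
  (\forall t \ae (leb R), s <= t -> h t <= t <= h t + tau) ->
  (\forall t \ae (leb R), s <= t -> b0 <= b t) ->
  (\forall t \ae (leb R), s <= t -> is_derive t 1 B (b t)) ->
  (\forall t \ae (leb R), s <= t ->
     B t - B (Num.max (h t) s) <= (expR 1)^-1) ->
  (forall t, s <= t -> 0 <= B t) ->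
  (forall p q, s <= p -> p <= q -> 0 <= B q - B p <= k * (q - p)) ->
  0 <= gamma -> 0 < b0 ->
  A * (K * expR (gamma * (delta + tau))) + 3 * Phi * expR (gamma * tau) <=
    c * (1 - gamma / b0) ->
  2 * Phi <= c ->
  (\forall t \ae (leb R), s <= t -> t <= T ->
     `|x t| <= K * expR (- gamma * (t - s))) ->
  \forall t \ae (leb R), s <= t -> t <= T ->
     `|x t| <= (c + A * (K * expR (gamma * delta))) * expR (- gamma * (t - s)).
Proof.
move=> s0 sT solx phiP PhiK aA A1 gle gN hN gd hd bb0 dB BH B0 Bk g0 b00 cF cPhi
  xK.
have Phi0 : 0 <= Phi by apply: le_trans (phiP s _).
have K0 : 0 <= K by exact: le_trans PhiK.
have A0 : 0 <= A by apply: le_trans (aA s _).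
pose w t := expR (- gamma * (t - s)).
have w0 t : 0 <= w t by exact: expR_ge0.
have wS d p q : q - p <= d -> w p <= expR (gamma * d) * w q.
  move=> qpd; rewrite /w -expRD ler_expR.
  have : gamma * (q - p) <= gamma * d by rewrite ler_wpM2l.
  by rewrite !mulNr !mulrBr; clear; lra.
have xP t : t <= s -> `|x t| <= Phi.
  by move=> ts; rewrite (sol_init solx)// phiP.
have xK0 : \forall t \ae (leb R), t <= T -> `|x t| <= K * w t.
  apply: filterS xK => t xKt tT; have [st|/ltW ts] := leP s t; first exact: xKt.
  apply: (le_trans (xP _ ts)); apply: (le_trans PhiK).
  rewrite ler_peMr// -expR0 ler_expR mulNr -mulrN mulr_ge0//.
  by move: ts; clear; lra.
have xg : \forall t \ae (leb R), s <= t -> t <= T ->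
    `|x (g t)| <= K * expR (gamma * delta) * w t.
  apply: filterS2 gd (ae_comp_nonsingular gN xK0) => t gdt xgt st tT.
  have t0 := le_trans s0 st.
  apply: (le_trans (xgt t0 (le_trans (gle _ t0) tT))).
  by rewrite -mulrA ler_wpM2l// wS// gdt.
have xgh : \forall t \ae (leb R), s <= t -> t <= T -> s <= h t ->
    `|x (g (h t))| <= K * expR (gamma * (delta + tau)) * w t.
  apply: filterS2 hd (ae_comp_nonsingular hN xg) => t hdt xgt st tT sht.
  have /andP[ht th] := hdt st.
  apply: (le_trans (xgt (le_trans s0 st) sht (le_trans ht tT))).
  rewrite mulrDr expRD mulrA -!mulrA ler_wpM2l// ler_wpM2l ?expR_ge0//.
  by rewrite wS//; move: th; clear; lra.
pose y := neutral_part a g x.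
have ys : `|y s| <= 2 * Phi.
  rewrite /y /neutral_part; apply: (le_trans (ler_normB _ _)).
  have := xP _ (lexx s); have := xP _ (gle _ s0).
  rewrite normrM => xgs xs.
  have : `|a s| * `|x (g s)| <= 1 * Phi.
    by apply: ler_pM => //; exact: le_trans (aA s _) A1.
  by move: xs; clear; lra.
have c0 : 0 <= c by apply: le_trans cPhi; rewrite mulr_ge0.
pose F := A * (K * expR (gamma * (delta + tau))) + 3 * Phi * expR (gamma * tau).
have F1 : 0 <= A * (K * expR (gamma * (delta + tau))).
  by rewrite !mulr_ge0// expR_ge0.
have F2 : 0 <= 3 * Phi * expR (gamma * tau) by rewrite !mulr_ge0// expR_ge0.
have forced : \forall t \ae (leb R), s <= t -> t <= T ->
     [/\ is_derive t 1 B (b t), b0 <= b t, s <= Num.max (h t) s <= t,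
         B t - B (Num.max (h t) s) <= (expR 1)^-1 &
         derivable y t 1 /\
         `|derive1 y t + b t * y (Num.max (h t) s)| <= b t * (F * w t)].
  apply: filterS2 (filterI dB BH)
    (filterI (filterI bb0 hd) (filterI xgh (sol_eq solx))).
  move=> t [dBt BHt] [[bbt hdt] [xght eqt]] st tT.
  have /andP[ht th] := hdt st; have [dy y'] := eqt st.
  have bt0 : 0 <= b t by exact: le_trans (ltW b00) (bbt st).
  split; [exact: dBt|exact: bbt| |exact: BHt|split; first exact: dy].
    by rewrite le_max lexx orbT ge_max ht st.
  have -> : derive1 y t + b t * y (Num.max (h t) s) =
      b t * (y (Num.max (h t) s) - x (h t)).
    have -> : derive1 y t = - (b t * x (h t)) by apply/eqP; rewrite -addr_eq0 y'.
    by ring.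
  rewrite normrM ger0_norm// ler_wpM2l// mulrDl.
  have [sh|hs] := leP s (h t).
    rewrite /y /neutral_part addrAC subrr add0r normrN normrM.
    apply: (@le_trans _ _ (A * (K * expR (gamma * (delta + tau))) * w t)).
      by rewrite -mulrA; apply: ler_pM => //; [exact: aA|exact: xght].
    by rewrite lerDl mulr_ge0.
  apply: (@le_trans _ _ (3 * Phi)).
    apply: (le_trans (ler_normB _ _)).
    by have := xP _ (ltW hs); move: ys; clear; lra.
  apply: (@le_trans _ _ (3 * Phi * expR (gamma * tau) * w t)).
    rewrite -mulrA ler_peMr ?mulr_ge0// /w -expRD -expR0 ler_expR.
    have : gamma * (t - s) <= gamma * tau.
      by rewrite ler_wpM2l//; move: th hs; clear; lra.
    by rewrite mulNr; clear; lra.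
  by rewrite lerDr mulr_ge0.
have yc t : s <= t -> t <= T -> `|y t| <= c * w t.
  move=> st tT.
  apply: (forced_delay_decay (B := B) (H := fun t => Num.max (h t) s)
    (k := k) (b := b) st _ B0 _ g0 b00 c0 cF _ (le_trans ys cPhi)).
  - by apply: absolutely_continuousS (sol_ac solx T).
  - by move=> p q sp pq _; exact: Bk.
  - by apply: filterS forced => r fr sr rt; exact: fr sr (le_trans rt tT).
apply: filterS xg => t xgt st tT.
have -> : x t = y t + a t * x (g t) by rewrite /y /neutral_part subrK.
apply: (le_trans (ler_normD _ _)); rewrite mulrDl; apply: lerD; first exact: yc.
by rewrite normrM -mulrA; apply: ler_pM => //; [exact: aA|exact: xgt].
Qed.

(** As [gamma] tends to [0], the inequalities become [A <= (A + 1/2) / 2] and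
[3 <= 6], which hold strictly. The first condition yields the factor
[alpha = (A + 1/2) / 2 < 1/2]; the last leaves room for the initial function. *)
Lemma decay_rate (R : realType) (A b0 delta tau : R) :
  0 <= A -> A < 2^-1 -> 0 < b0 -> 0 <= delta -> 0 <= tau ->
  exists2 gamma : R, 0 < gamma &
    [/\ A * expR (gamma * (delta + tau)) <= (A + 2^-1) / 2 * (1 - gamma / b0),
        A * expR (gamma * delta) <= (A + 2^-1) / 2 &
        3 * expR (gamma * tau) <= 6 * (1 - gamma / b0)].
Proof.
move=> A0 A2 b00 d0 ta0.
have ib0 : 0 < b0^-1 by rewrite invr_gt0.
pose kappa := b0^-1 + (delta + tau).
have kappa0 : 0 < kappa by rewrite ltr_pwDl// addr_ge0.
(* With this choice the three small quantities [gamma / b0], [gamma delta] and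
   [gamma tau] add up to [(1/2 - A) / 2 <= 1/4]. *)
pose gamma := (2^-1 - A) / 2 / kappa.
have g0 : 0 < gamma by rewrite !divr_gt0// subr_gt0.
have gk : gamma / b0 + (gamma * delta + gamma * tau) = (2^-1 - A) / 2.
  by rewrite -!mulrDr divfK// gt_eqF.
have p0 : 0 < gamma / b0 by exact: mulr_gt0.
have q0 : 0 <= gamma * delta by rewrite mulr_ge0// ltW.
have r0 : 0 <= gamma * tau by rewrite mulr_ge0// ltW.
exists gamma => //.
have expB (z : R) : expR z * (1 - z) <= 1.
  have /(ler_wpM2l (expR_ge0 z)) := expR_ge1Dx (- z).
  by rewrite expRxMexpNx_1.
have E1 : A * expR (gamma * (delta + tau)) <=
    (A + 2^-1) / 2 * (1 - gamma / b0).
  rewrite mulrDr.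
  move: (expB (gamma * delta + gamma * tau)) (expR_gt0 (gamma * delta + gamma * tau)).
  move: (expR _) => E; move: gk p0 q0 r0.
  move: (gamma / b0) (gamma * delta) (gamma * tau) => p q r.
  clear -A0 A2 => gk p0 q0 r0 EB E0.
  have pz : 0 <= p * (q + r) by rewrite mulr_ge0 ?addr_ge0// ltW.
  have al0 : 0 <= (A + 2^-1) / 2 by lra.
  have A3 : 0 <= (2^-1 - A) * (3 / 2 - A) by rewrite mulr_ge0//; lra.
  have AE : A <= (A + 2^-1) / 2 * (1 - p) * (1 - (q + r)).
    apply: (@le_trans _ _ ((A + 2^-1) / 2 * (1 - (2^-1 - A) / 2))); first by lra.
    by rewrite -[leRHS]mulrA ler_wpM2l//; lra.
  have pp : 0 <= (A + 2^-1) / 2 * (1 - p) by rewrite mulr_ge0//; lra.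
  have := ler_wpM2r (ltW E0) AE; have := ler_wpM2l pp EB; lra.
split => //.
- apply: (@le_trans _ _ (A * expR (gamma * (delta + tau)))).
    by rewrite ler_wpM2l// ler_expR mulrDr lerDl.
  apply: (le_trans E1); rewrite ger_pMr; first lra.
  by rewrite divr_gt0// ltr_wpDl// invr_gt0.
- move: (expB (gamma * tau)) (expR_gt0 (gamma * tau)).
  move: (expR _) => E; move: gk p0 q0 r0.
  move: (gamma / b0) (gamma * delta) (gamma * tau) => p q r.
  clear -A0 A2 => gk p0 q0 r0 EB E0.
  nra.
Qed.

(** The bounds [K_(n+1) = rho K_n + C] converge to the fixed point
[C / (1 - rho)]; countably many null sets are discarded, so the limit is a
bound almost everywhere as well. *)
Lemma ae_bound_iterate (R : realType) (D : set R) (f w : R -> R)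
    (rho C K0 : R) :
  0 <= rho -> rho < 1 -> 0 <= C -> C <= K0 -> (forall t, 0 <= w t) ->
  (\forall t \ae (leb R), D t -> `|f t| <= K0 * w t) ->
  (forall K, C <= K -> (\forall t \ae (leb R), D t -> `|f t| <= K * w t) ->
     \forall t \ae (leb R), D t -> `|f t| <= (rho * K + C) * w t) ->
  \forall t \ae (leb R), D t -> `|f t| <= C / (1 - rho) * w t.
Proof.
move=> rho0 rho1 C0 CK0 w0 fK0 step.
pose u n := iter n (fun K => rho * K + C) K0.
have CK n : C <= u n.
  by elim: n => //= n IHn; rewrite lerDr mulr_ge0// (le_trans C0).
have fu n : \forall t \ae (leb R), D t -> `|f t| <= u n * w t.
  by elim: n => //= n IHn; exact: step.
have uE n : u n = C / (1 - rho) + rho ^+ n * (K0 - C / (1 - rho)).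
  elim: n => [|n IHn]; first by rewrite expr0 mul1r addrC subrK.
  rewrite /= -/(u n) IHn exprS.
  have /divfK CE : 1 - rho != 0 by rewrite subr_eq0 gt_eqF.
  by move: (C / _) (CE C) => z <-; ring.
apply: filterS (ae_foralln fu) => t ftu Dt.
have cu : u n * w t @[n --> \oo] --> C / (1 - rho) * w t.
  apply: cvgM; last exact: cvg_cst.
  rewrite (_ : u = fun n => C / (1 - rho) + rho ^+ n * (K0 - C / (1 - rho))).
    rewrite -[X in _ --> X]addr0 -(mul0r (K0 - C / (1 - rho))).
    apply: cvgD; first exact: cvg_cst.
    apply: cvgM; last exact: cvg_cst.
    by apply: cvg_expr; rewrite ger0_norm.
  by apply/funext.
apply: (@ler_cvg_to _ _ _ _ (fun=> `|f t|) _ _ _ (cvg_cst _) cu).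
by apply: nearW => n; exact: ftu.
Qed.

Unset Implicit Arguments.

(* a, b, g, h are functions on [0, +oo[ : their values at negative arguments
   are never used. The inequality g t <= t is required at every t, because the
   initial value of x t - a t * x (g t) at t = sigma is determined by phi only
   if g sigma <= sigma; all other inequalities hold almost everywhere. *)
Theorem theorem3p2 (R : realType) (a b g h : R -> R)
  (a_meas : lebesgue_measurable_fun `[0, +oo[ a)
  (b_meas : lebesgue_measurable_fun `[0, +oo[ b)
  (g_meas : lebesgue_measurable_fun `[0, +oo[ g)
  (h_meas : lebesgue_measurable_fun `[0, +oo[ h)
  (a_bnd : ess_bounded `[0, +oo[ a)
  (b_bnd : ess_bounded `[0, +oo[ b)
  (g_bnd : loc_ess_bounded 0 g)
  (h_bnd : loc_ess_bounded 0 h)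
  (g_le : forall t, 0 <= t -> g t <= t)
  (h_le : \forall t \ae (leb R), 0 <= t -> h t <= t)
  (g_lim : g t @[t --> +oo] --> +oo)
  (h_lim : h t @[t --> +oo] --> +oo)
  (g_null : forall U : set R, (leb R).-negligible U ->
     (leb R).-negligible (`[0, +oo[ `&` g @^-1` U))
  (h_null : forall U : set R, (leb R).-negligible U ->
     (leb R).-negligible (`[0, +oo[ `&` h @^-1` U))
  (b_ge0 : \forall t \ae (leb R), 0 <= t -> 0 <= b t)
  (t0 delta tau b0 : R)
  (t0_ge0 : 0 <= t0) (delta_gt0 : 0 < delta) (tau_gt0 : 0 < tau)
  (b0_gt0 : 0 < b0)
  (g_delay : \forall t \ae (leb R), t0 <= t -> t - g t <= delta)
  (h_delay : \forall t \ae (leb R), t0 <= t -> t - h t <= tau)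
  (b_lb : \forall t \ae (leb R), t0 <= t -> b0 <= b t)
  (b_int : \forall t \ae (leb R), t0 <= t ->
     (\int[leb R]_(s in `[h t, t]) (zero_ext `[0%R, +oo[ b s)%:E
        <= ((expR 1)^-1)%:E)%E)
  (a_repr : forall t, t0 <= t -> ((`|a t|)%:E <= ess_norm `[t0, +oo[ a)%E)
  (a_lt : (ess_norm `[t0, +oo[ a < (2^-1)%:E)%E) :
  exponentially_stable t0 a b g h.
Proof.
pose A := fine (ess_norm `[t0, +oo[ a).
have AE : ess_norm `[t0, +oo[ a = A%:E.
  rewrite /A fineK// fin_numElt (lt_trans a_lt) ?ltry// andbT.
  by rewrite (lt_le_trans _ (a_repr t0 (lexx t0)))// ltNyr.
have aA t : t0 <= t -> `|a t| <= A by move/a_repr; rewrite AE lee_fin.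
have A2 : A < 2^-1 by rewrite -lte_fin -AE.
have A0 : 0 <= A by apply: le_trans (aA _ (lexx t0)).
have [gamma g0 [E1 E2 E3]] :=
  decay_rate A0 A2 b0_gt0 (ltW delta_gt0) (ltW tau_gt0).
have [B [k [Bk B0 dB BI]]] := integral_coefficient b_meas b_bnd b_ge0.
pose al := (A + 2^-1) / 2.
have rho1 : 2 * al < 1 by rewrite /al; move: A2; clear; lra.
have rho0 : 0 <= 2 * al by rewrite /al; move: A0; clear; lra.
exists (6 / (1 - 2 * al)), gamma; split => //.
  by rewrite divr_gt0// subr_gt0.
move=> s phi x t0s [_ [M0 phiM]] solx.
have s0 : 0 <= s by exact: le_trans t0s.
set Phi := sup _.
have phiP r : r <= s -> `|phi r| <= Phi.
  move=> rs; apply: sup_upper_bound; last by exists r => //=; rewrite in_itv.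
  split; last by exists M0.
  by exists `|phi s|, s => //=; rewrite in_itv/= lexx.
have Phi0 : 0 <= Phi by apply: le_trans (phiP s (lexx s)).
pose w t := expR (- gamma * (t - s)).
(* The bound does not depend on [n]; finite intervals are used because an
   a priori bound on [x] is available only there. *)
have bound n : \forall t \ae (leb R), s <= t <= s + n%:R ->
    `|x t| <= 6 * Phi / (1 - 2 * al) * w t.
  have sT : s <= s + n%:R by rewrite lerDl.
  have [k0 k00 xk0] := ess_bounded_ae (sol_bounded solx (s + n%:R)).
  pose K0 := 6 * Phi + k0 * expR (gamma * n%:R).
  have Phi6 : Phi <= 6 * Phi by move: Phi0; clear; lra.
  apply: (@ae_bound_iterate _ [set t | s <= t <= s + n%:R] x w (2 * al)
    (6 * Phi) K0) => //.
  - by rewrite mulr_ge0.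
  - by rewrite lerDl mulr_ge0// expR_ge0.
  - by move=> t; exact: expR_ge0.
  - apply: filterS xk0 => t xk0 /andP[st tT].
    apply: le_trans (xk0 _) _; first by rewrite /= in_itv/= st.
    rewrite mulrDl ler_wpDl//; first by rewrite !mulr_ge0// expR_ge0.
    rewrite -mulrA ler_peMr// -expRD -[leLHS]expR0 ler_expR mulNr -mulrBr.
    by rewrite mulr_ge0 ?(ltW g0)//; move: tT; clear; lra.
  move=> K PK xK.
  have PhiK : Phi <= K by exact: le_trans PK.
  have K0' : 0 <= K by exact: le_trans PhiK.
  (* The neutral part is bounded by [(alpha K + 6 Phi) w], and the term
     [a x(g)] contributes at most another [alpha K w]. *)
  have step := solution_bound_step (c := al * K + 6 * Phi) s0 sT solx phiP PhiK
    (fun t st => aA t (le_trans t0s st)) _ g_le g_null h_null _ _ _ _ _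
    (fun t st => B0 t (le_trans s0 st))
    (fun p q sp => Bk p q (le_trans s0 sp)) (ltW g0) b0_gt0.
  have : \forall t \ae (leb R), s <= t -> t <= s + n%:R ->
     `|x t| <= ((al * K + 6 * Phi) + A * (K * expR (gamma * delta))) * w t.
    apply: (step delta tau).
    - by move: A2; clear; lra.
    - by apply: filterS g_delay => t gt st; apply: gt; exact: le_trans st.
    - apply: filterS2 h_le h_delay => t ht hd st.
      rewrite ht ?(le_trans s0 st)//=.
      by rewrite -lerBlDl hd// (le_trans t0s).
    - by apply: filterS b_lb => t bt st; apply: bt; exact: le_trans st.
    - by apply: filterS dB => t dBt st; apply: dBt; exact: le_trans st.
    - apply: filterS2 h_le b_int => t ht bt st.
      rewrite -lee_fin; apply: le_trans (bt (le_trans t0s st)).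
      apply: BI; rewrite ?le_max ?s0 ?orbT ?lexx//.
      by rewrite ge_max st ht ?(le_trans s0 st).
    - rewrite [leRHS]mulrDl; apply: lerD.
        rewrite mulrCA [leRHS]mulrAC [leRHS]mulrC.
        by rewrite ler_wpM2l.
      rewrite mulrAC [leRHS]mulrAC.
      by rewrite ler_wpM2r.
    - rewrite -[leLHS]add0r lerD//; last by move: Phi0; clear; lra.
      by rewrite mulr_ge0// /al; move: A0; clear; lra.
    - by apply: filterS xK => t xKt st tT; apply: xKt; rewrite /= st.
  apply: filterS => t xt /= /andP[st tT].
  apply: (le_trans (xt st tT)); rewrite ler_wpM2r ?expR_ge0//.
  have : A * (K * expR (gamma * delta)) <= al * K.
    by rewrite mulrCA mulrC ler_wpM2r.
  by clear; lra.
apply: filterS (ae_foralln bound) => t xt st.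
have [n tn] : exists n : nat, t <= s + n%:R.
  exists (Num.truncn (t - s)).+1.
  by rewrite -lerBlDl ltW// truncnS_gt.
rewrite [leRHS]mulrAC -[6 / _ * _]mulrAC.
by apply: (xt n); rewrite st.
Qed.
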